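(* $\mathfrak{rc}_0$ is a Lie algebra with respect to the Ihara bracket $\{\cdot,\cdot\}$. Moreover, for any $\psi_1,\psi_2\in\mathfrak{rc}_0$, $$\mu(\{\psi_1,\psi_2\})=-d_0^L(\{\psi_1,\psi_2\})-d_1^R(\{\psi_1,\psi_2\}).$$
   Context: Let $k$ be a field of characteristic zero, $A=k\langle\langle x_0,x_1\rangle\rangle$ the algebra of noncommutative formal power series with counit $\varepsilon$ (constant term), $c_w(\varphi)$ the coefficient of the word $w$ in $\varphi\in A$, and $\mathfrak{fr}_k(x_0,x_1)\subset A$ the (completed) free Lie algebra of formal Lie series. $\mathfrak{fr}^{>1}_k(x_0,x_1)$ is the set of $\psi\in\mathfrak{fr}_k(x_0,x_1)$ with $\psi(x_0,0)=\psi(0,x_1)=0$, and $\mathrm{Skew}=\{\psi\in\mathfrak{fr}^{>1}_k(x_0,x_1)\mid\psi(x_0,x_1)=-\psi(x_1,x_0)\}$. Ihara bracket: $\{\psi_1,\psi_2\}=d_{\psi_2}(\psi_1)-d_{\psi_1}(\psi_2)-[\psi_1,\psi_2]$, where $d_\psi$ is the derivation with $d_\psi(x_0)=0$, $d_\psi(x_1)=[x_1,\psi]$. Reduced coaction. Every $\varphi\in A$ is uniquely written $\varphi=\varepsilon(\varphi)+x_0d^R_0(\varphi)+x_1d^R_1(\varphi)=\varepsilon(\varphi)+d^L_0(\varphi)x_0+d^L_1(\varphi)x_1$. The reduced coaction $\mu:A\to A$ is the (continuous) linear map with $\mu(x_0)=\mu(x_1)=0$ and $\mu(k_1\cdots k_n)=\sum_{i=1}^{n-1}k_1\cdots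 k_{i-1}(k_i\odot k_{i+1})k_{i+2}\cdots k_n$ for letters $k_j\in\{x_0,x_1\}$, where $x_i\odot x_j=\delta_{ij}x_i$. For a Lie series $\eta$ with $c_{x_0}(\eta)=c_{x_1}(\eta)=0$ let $r_\eta(x)=\sum_{l\ge0}c_{x_0^{l+1}x_1}(\eta)x^{l+1}$. The reduced coaction equation for $\eta$ is $\mu(\eta)=-r_\eta(x_1)+r_\eta(-x_0)-d^L_0(\eta)-d^R_1(\eta)$. $\mathfrak{rc}$ is the set of $\psi\in\mathrm{Skew}$ satisfying this equation, and $\mathfrak{rc}_0\subset\mathfrak{rc}$ is the subset of elements whose coefficient of the commutator $[x_0,x_1]$ is $0$. *)

(* Defs.v *)
From HB Require Import structures.
From mathcomp Require Import all_boot all_algebra.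
From mathcomp Require Import boolp.

Set Implicit Arguments.
Unset Strict Implicit.
Unset Printing Implicit Defensive.

Import GRing.Theory.
Local Open Scope ring_scope.

(* The letters x_0 and x_1 are [false] and [true]. *)
Notation word := (seq bool).

(* k<<x_0,x_1>>: a series is the family of its coefficients.  It is wrapped in
   a record so that it does not inherit pointwise structures of functions. *)
Record series (k : fieldType) := Series { coef :> word -> k }.

HB.instance Definition _ (k : fieldType) := gen_eqMixin (series k).
HB.instance Definition _ (k : fieldType) := gen_choiceMixin (series k).

Section SeriesAlgebra.
Variable k : fieldType.
Implicit Types (f g h : series k) (w : word) (a : k).

Lemma seriesP f g : f =1 g -> f = g.
Proof. by case: f g => [f] [g] /= /funext ->. Qed.

Definition szero := Series (fun _ => 0 : k).
Definition sopp f := Series (fun w => - f w).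
Definition sadd f g := Series (fun w => f w + g w).
Definition sscale a f := Series (fun w => a * f w).
Definition mono w := Series (fun v => (v == w)%:R : k).
Definition smul f g :=
  Series (fun w => \sum_(i < (size w).+1) f (take i w) * g (drop i w)).

Fact saddA : associative sadd.
Proof. by move=> f g h; apply: seriesP => w /=; rewrite addrA. Qed.
Fact saddC : commutative sadd.
Proof. by move=> f g; apply: seriesP => w /=; rewrite addrC. Qed.
Fact sadd0 : left_id szero sadd.
Proof. by move=> f; apply: seriesP => w /=; rewrite add0r. Qed.
Fact saddN : left_inverse szero sopp sadd.
Proof. by move=> f; apply: seriesP => w /=; rewrite addNr. Qed.

HB.instance Definition _ :=
  GRing.isZmodule.Build (series k) saddA saddC sadd0 saddN.

Fact sscaleA a b f : sscale a (sscale b f) = sscale (a * b) f.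
Proof. by apply: seriesP => w /=; rewrite mulrA. Qed.
Fact sscale1 : left_id 1 sscale.
Proof. by move=> f; apply: seriesP => w /=; rewrite mul1r. Qed.
Fact sscaleDr : right_distributive sscale +%R.
Proof. by move=> a f g; apply: seriesP => w /=; rewrite mulrDr. Qed.
Fact sscaleDl f : {morph sscale^~ f : a b / a + b}.
Proof. by move=> a b; apply: seriesP => w /=; rewrite mulrDl. Qed.

HB.instance Definition _ :=
  GRing.Zmodule_isLmodule.Build k (series k) sscaleA sscale1 sscaleDr sscaleDl.

Fact smulDl : left_distributive smul +%R.
Proof.
move=> f g h; apply: seriesP => w /=; rewrite -big_split /=.
by apply: eq_bigr => i _; rewrite mulrDl.
Qed.
Fact smulDr : right_distributive smul +%R.
Proof.
move=> f g h; apply: seriesP => w /=; rewrite -big_split /=.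
by apply: eq_bigr => i _; rewrite mulrDr.
Qed.
Fact sscaleAl a f g : a *: smul f g = smul (a *: f) g.
Proof.
apply: seriesP => w /=; rewrite mulr_sumr.
by apply: eq_bigr => i _; rewrite mulrA.
Qed.
Fact sscaleAr a f g : a *: smul f g = smul f (a *: g).
Proof.
apply: seriesP => w /=; rewrite mulr_sumr.
by apply: eq_bigr => i _; rewrite mulrCA.
Qed.

(* phi = eps(phi) + x_0 d^R_0(phi) + x_1 d^R_1(phi)
       = eps(phi) + d^L_0(phi) x_0 + d^L_1(phi) x_1;
   see [dR_decomp] and [dL_decomp]. *)
Definition dR (i : bool) f := Series (fun w => f (i :: w)).
Definition dL (i : bool) f := Series (fun w => f (rcons w i)).

Fact smul_cons f g i w :
  smul f g (i :: w) = f [::] * g (i :: w) + smul (dR i f) g w.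
Proof. by rewrite /= big_ord_recl /=. Qed.

Fact smulA : associative smul.
Proof.
move=> f g h; apply: seriesP => w; elim: w f g => [|i w IHw] f g.
  by rewrite /= !big_ord1 /= ?big_ord1 /= mulrA.
rewrite !smul_cons IHw.
have ->: dR i (smul f g) = f [::] *: dR i g + smul (dR i f) g.
  by apply: seriesP => v; rewrite /= big_ord_recl.
rewrite smulDl -sscaleAl /= big_ord1 /= mulrDr !mulrA -addrA.
by congr (_ + _).
Qed.

Fact smul1 : left_id (mono [::]) smul.
Proof.
move=> f; apply: seriesP => -[|i w]; first by rewrite /= big_ord1 /= mul1r.
rewrite smul_cons /= mul1r big1 ?addr0 // => j _.
by rewrite mul0r.
Qed.

Fact smulr1 : right_id (mono [::]) smul.
Proof.
move=> f; apply: seriesP => w; elim: w f => [|i w IHw] f.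
  by rewrite /= big_ord1 /= mulr1.
by rewrite smul_cons IHw /= mulr0 add0r.
Qed.

Fact mono_nil_neq0 : mono [::] != 0.
Proof.
by apply/eqP => /(congr1 (fun f => coef f [::]))/eqP; rewrite oner_eq0.
Qed.

HB.instance Definition _ := GRing.Zmodule_isNzRing.Build (series k)
  smulA smul1 smulr1 smulDl smulDr mono_nil_neq0.
HB.instance Definition _ :=
  GRing.Lmodule_isLalgebra.Build k (series k) sscaleAl.
HB.instance Definition _ :=
  GRing.Lalgebra_isAlgebra.Build k (series k) sscaleAr.

End SeriesAlgebra.

Section Definitions.
Variable k : fieldType.
Implicit Types (f phi psi eta u v : series k) (w : word).

Definition eps phi : k := phi [::].

Definition letter (i : bool) : series k := mono k [:: i].
Notation X0 := (letter false).
Notation X1 := (letter true).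

Definition lie u v : series k := u * v - v * u.

Definition hcomp (n : nat) phi : series k :=
  Series (fun w => if size w == n then phi w else 0).

Inductive lie_poly : series k -> Prop :=
| lie_poly_letter i : lie_poly (letter i)
| lie_poly_lin a u v : lie_poly u -> lie_poly v -> lie_poly (a *: u + v)
| lie_poly_lie u v : lie_poly u -> lie_poly v -> lie_poly (lie u v).

Definition lie_series psi : Prop := forall n, lie_poly (hcomp n psi).

(* The continuous linear map sending each word w to F w.  It is meaningful only
   when every F w has no term of degree < |w| - 1: then only the words w with
   |w| <= |v| + 1 contribute to the coefficient of v. *)
Definition lin_ext (F : word -> series k) phi : series k :=
  Series (fun v : word =>
    \sum_(n < (size v).+2) \sum_(w : n.-tuple bool) phi w * F w v).

(* phi(a, b), for a and b without constant term *)
Definition subst phi (a b : series k) : series k :=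
  lin_ext (fun w => \prod_(i <- w) (if i then b else a)) phi.

Definition fr1 psi : Prop :=
  [/\ lie_series psi, subst psi X0 0 = 0 & subst psi 0 X1 = 0].

Definition skew psi : Prop := fr1 psi /\ subst psi X0 X1 = - subst psi X1 X0.

(* d_psi, the continuous derivation with d_psi(x_0) = 0 and
   d_psi(x_1) = [x_1, psi]; its value on words is given by the Leibniz rule. *)
Definition ider_letter psi (i : bool) : series k :=
  if i then lie X1 psi else 0.
Definition ider_word psi w : series k :=
  \sum_(j < size w) mono k (take j w) * ider_letter psi (nth false w j)
                    * mono k (drop j.+1 w).
Definition ider psi phi : series k := lin_ext (ider_word psi) phi.

Definition ihara psi1 psi2 : series k :=
  ider psi2 psi1 - ider psi1 psi2 - lie psi1 psi2.

Definition odot (i j : bool) : series k := (i == j)%:R *: letter i.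
Definition mu_word w : series k :=
  \sum_(j < (size w).-1) mono k (take j w)
     * odot (nth false w j) (nth false w j.+1) * mono k (drop j.+2 w).
Definition mu phi : series k := lin_ext mu_word phi.

(* Coefficients of r_eta(x) = \sum_(l >= 0) c_{x_0^{l+1} x_1}(eta) x^{l+1} *)
Definition r_coef eta (n : nat) : k :=
  if n is 0 then 0 else eta (rcons (nseq n false) true).

(* The value at u, a series without constant term, of the power series in one
   variable with coefficients c *)
Definition ps_eval (c : nat -> k) u : series k :=
  Series (fun w => \sum_(n < (size w).+1) c n * (u ^+ n) w).

Definition r_series eta u : series k := ps_eval (r_coef eta) u.

Definition reduced_coaction_eq eta : Prop :=
  mu eta = - r_series eta X1 + r_series eta (- X0) - dL false eta - dR true eta.

Definition rc psi : Prop := skew psi /\ reduced_coaction_eq psi.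

(* In a formal Lie series the coefficient of [x_0, x_1] is the scalar c such
   that the component of degree 2 is c [x_0, x_1]. *)
Definition lie2_coef psi (c : k) : Prop := hcomp 2 psi = c *: lie X0 X1.

Definition rc0 psi : Prop := rc psi /\ lie2_coef psi 0.

End Definitions.

(* The subset L of V is a Lie algebra over k for the restriction of br. *)
Record is_lie_algebra (k : fieldType) (V : lmodType k) (L : V -> Prop)
    (br : V -> V -> V) : Prop := IsLieAlgebra {
  lie_algebra0 : L 0;
  lie_algebraP : forall (a : k) u v, L u -> L v -> L (a *: u + v);
  lie_algebra_br : forall u v, L u -> L v -> L (br u v);
  lie_algebra_linl : forall (a : k) u v w, L u -> L v -> L w ->
    br (a *: u + v) w = a *: br u w + br v w;
  lie_algebra_linr : forall (a : k) u v w, L u -> L v -> L w ->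
    br u (a *: v + w) = a *: br u v + br u w;
  lie_algebra_alt : forall u, L u -> br u u = 0;
  lie_algebra_jacobi : forall u v w, L u -> L v -> L w ->
    br u (br v w) + br v (br w u) + br w (br u v) = 0
}.

Section Checks.
Variable k : fieldType.
Implicit Types (phi : series k) (F : word -> series k) (w v : word).

Lemma dR_decomp phi :
  phi = (eps phi)%:A + letter k false * dR false phi
        + letter k true * dR true phi.
Proof.
apply: seriesP => -[|i w].
  by rewrite /= !big_ord1 /= mulr1 !mul0r !addr0.
have E (j : bool) : (letter k j * dR j phi) (i :: w) = (i == j)%:R * phi (i :: w).
  rewrite /= !big_ord_recl /= take0 drop0 mul0r add0r big1 => [|l _].
    by rewrite addr0 eqseq_cons eqxx andbT; case: eqP => [->|_]; rewrite ?mul0r.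
  by case: w l => [|b w] [l Hl] //=; rewrite eqseq_cons andbF mul0r.
have -> : ((eps phi)%:A + letter k false * dR false phi
           + letter k true * dR true phi) (i :: w)
        = eps phi * 0 + (letter k false * dR false phi) (i :: w)
          + (letter k true * dR true phi) (i :: w) by [].
by rewrite !E mulr0 add0r -mulrDl -natrD; case: i {E}; rewrite mul1r.
Qed.

Lemma dL_decomp phi :
  phi = (eps phi)%:A + dL false phi * letter k false
        + dL true phi * letter k true.
Proof.
apply: seriesP => w; case/lastP: w => [|w i].
  by rewrite /= !big_ord1 /= mulr1 !mulr0 !addr0.
have E (j : bool) :
    (dL j phi * letter k j) (rcons w i) = (i == j)%:R * phi (rcons w i).
  rewrite /= size_rcons !big_ord_recr /= big1 => [|l _].
    have -> : drop (size w) (rcons w i) = [:: i].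
      by rewrite -cats1 drop_size_cat.
    have -> : take (size w) (rcons w i) = w by rewrite -cats1 take_size_cat.
    have -> : drop (size w).+1 (rcons w i) = [::].
      by rewrite drop_oversize ?size_rcons.
    rewrite add0r mulr0 addr0 eqseq_cons andbT mulrC.
    by case: eqP => [->|_]; rewrite ?mul0r.
  case: eqP => [E|_]; last by rewrite mulr0.
  have lt_lw : (l < size w)%N := ltn_ord l.
  have := size_drop l (rcons w i); rewrite E size_rcons (subSn (ltnW lt_lw)).
  by case=> /esym/eqP; rewrite subn_eq0 leqNgt lt_lw.
have -> : ((eps phi)%:A + dL false phi * letter k false
           + dL true phi * letter k true) (rcons w i)
        = eps phi * (rcons w i == [::])%:R
          + (dL false phi * letter k false) (rcons w i)
          + (dL true phi * letter k true) (rcons w i) by [].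
have -> : (rcons w i == [::]) = false by case: (w).
by rewrite !E mulr0 add0r -mulrDl -natrD; case: i {E}; rewrite mul1r.
Qed.

Lemma lin_ext_mono F w :
  (forall v, ((size v).+1 < size w)%N -> F w v = 0) -> lin_ext F (mono k w) = F w.
Proof.
move=> F0; apply: seriesP => v /=.
have [lt_vw|le_wv] := ltnP (size v).+1 (size w).
  rewrite F0 // big1 // => n _; rewrite big1 // => t _ /=.
  have [E|] := eqVneq (tval t) w; last by rewrite mul0r.
  by rewrite E F0 // mulr0.
have lt_w : (size w < (size v).+2)%N by [].
rewrite (bigD1 (Ordinal lt_w)) //= (bigD1 (in_tuple w)) //= eqxx mul1r.
rewrite big1 ?addr0 => [|t nt]; last first.
  rewrite (_ : (tval t == w) = false) ?mul0r //; apply/negbTE.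
  by apply: contra nt => /eqP E; apply/eqP/val_inj.
rewrite big1 ?addr0 // => n nn; rewrite big1 // => t _.
have [E|] := eqVneq (tval t) w; last by rewrite mul0r.
by case/eqP: nn; apply: val_inj; rewrite /= -E size_tuple.
Qed.

End Checks.

(* Main.v *)
Require Import Defs.
From mathcomp Require Import all_boot all_algebra.
From HB Require Import structures.
From mathcomp Require Import ring.
Import GRing.Theory.
Local Open Scope ring_scope.

(** Write T(f) = d^L_0(f) + d^R_1(f).  For psi in rc_0 the coaction equation is
    mu(psi) = r(-x_0) - r(x_1) - T(psi), with r the series attached to psi, and
    the point is to compute (mu + T)({psi1,psi2}).

    First, r is even ([r_coef_odd]).  This is a depth two argument: in weight
    m + 2 with m > 0 even, the coefficients of x_0^m x_1 and x_1 x_0^m in the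
    coaction equation, together with the sign (-1)^(n+1) by which a Lie series
    transforms when words of length n are reversed, and with one shuffle
    relation, give (m + 3) c = 0 for the coefficient c of x_0^(m+1) x_1.  In
    weight 2 the vanishing is the condition that cuts rc_0 out of rc.  As r is
    even, r(x_0) and r(x_1) are fixed by the antipode S; as S anticommutes with
    mu and S(psi) = -psi, applying S to the coaction equation gives
    d^L_0 + d^R_1 = d^R_0 + d^L_1 on psi ([rc0_dLR_sym]).

    Next, mu is a derivation up to the terms in which the last letter of the
    left factor merges with the first letter of the right one ([muM]).  This
    measures the failure of mu to commute with the derivation d_psi
    ([mu_ider]): replacing each letter x_1 by [x_1,psi] creates insertions
    between consecutive letters; those between two letters x_1 cancel, those
    around a block of letters x_0 are r(x_0) and -r(x_0), which commute with
    the block and cancel too, and only terms at the two ends of the word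
    remain.  Then (mu + T)({psi1,psi2}) = 0 is a computation in the free algebra
    ([mu_ihara]).

    This is the coaction equation for {psi1,psi2}, because r vanishes for a
    bracket: psi1 and psi2 have depth (minimal degree in x_1) at least 1, so
    their bracket has depth at least 2.  The bracket stays skew because exchanging
    x_0 and x_1 turns d_psi into d_psi + ad psi when psi is skew
    ([swap_ider]), and it stays Lie because d_psi preserves Lie polynomials.
    The Jacobi identity follows from d_{psi1,psi2} = [d_psi2, d_psi1]
    ([ider_ihara]).

    Nearly all operator identities are proved by one principle,
    [letter_linear_eq0]: an additive operator that kills constants and commutes
    with left multiplication by letters is zero.  It replaces both the
    induction on words and the passage to infinite sums. *)

(** * Computing in the algebra of series *)

Ltac nc_expand :=
  rewrite ?(mulrDl, mulrDr, mulrN, mulNr, opprD, opprK, scalerDr, scalerN,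
            mulr0, mul0r, scaler0, mulr1, mul1r,
            =^~ scalerAl, =^~ scalerAr, mulrA).

(** Sums and scalings of series can carry different, convertible, algebraic
    structures, which rewriting does not identify: hence the conversions. *)
Ltac coef_push := repeat match goal with
  | |- context [@coef ?k (@Algebra.add ?V ?a ?b) ?w] =>
      change (@coef k (@Algebra.add V a b) w) with (@coef k a w + @coef k b w)
  | |- context [@coef ?k (@Algebra.opp ?V ?a) ?w] =>
      change (@coef k (@Algebra.opp V a) w) with (- @coef k a w)
  | |- context [@coef ?k (@Algebra.zero ?V) ?w] =>
      change (@coef k (@Algebra.zero V) w) with (0 : k)
  | |- context [@coef ?k (@GRing.scale ?R ?V ?e ?a) ?w] =>
      change (@coef k (@GRing.scale R V e a) w) with ((e : k) * @coef k a w)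
  end.

(** An identity between noncommutative polynomials in given series is linear in
    the monomials once it is expanded, so that, at each word, it becomes an
    identity of commutative polynomials in the coefficients of the monomials. *)
Ltac nc_ring := nc_expand; apply: seriesP => ?; coef_push; ring.

Section ReducedCoaction.
Set Implicit Arguments.
Unset Strict Implicit.
Unset Printing Implicit Defensive.
Variable k : fieldType.
Implicit Types (f g h phi psi eta : series k) (w : word) (a : k).
Implicit Types (c : nat -> k) (i j : bool).

Local Notation X := (letter k).
Local Notation X0 := (letter k false).
Local Notation X1 := (letter k true).

Lemma coefD f g w : (f + g) w = f w + g w. Proof. by []. Qed.
Lemma coefZ a f w : (a *: f) w = a * f w. Proof. by []. Qed.
Lemma coef_letterM i f w :
  (X i * f) w = if w is j :: w' then (i == j)%:R * f w' else 0.
Proof.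
case: w => [|j w]; first by rewrite /= big_ord1 /= mul0r.
have E : dR j (X i) = (i == j)%:R *: 1.
  apply: seriesP => v /=; rewrite eqseq_cons (eq_sym i).
  by case: (j == i); rewrite ?mul1r ?mul0r.
transitivity (0 * f (j :: w) + (dR j (X i) * f) w); first exact: smul_cons.
by rewrite mul0r add0r E -scalerAl mul1r.
Qed.

(** * Continuous extensions from words to series *)

Lemma sum_tupleS n (G : word -> k) :
  \sum_(w : n.+1.-tuple bool) G w =
  \sum_(w : n.-tuple bool) G (true :: w) + \sum_(w : n.-tuple bool) G (false :: w).
Proof.
transitivity (\sum_i \sum_(w : n.-tuple bool) G (i :: w)); last by rewrite big_bool.
rewrite pair_big /=.
rewrite (reindex (fun p : bool * n.-tuple bool => [tuple of p.1 :: p.2])) //=.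
exists (fun t => (thead t, [tuple of behead t])) => [[i t]|t] _ /=.
  by congr (_, _); apply: val_inj.
by rewrite -tuple_eta.
Qed.

Lemma sum_words_delta N (G : word -> k) w : (size w < N)%N ->
  \sum_(n < N) \sum_(v : n.-tuple bool) G v * (w == v)%:R = G w.
Proof.
move=> ltwN; rewrite (bigD1 (Ordinal ltwN)) //= (bigD1 (in_tuple w)) //= eqxx.
rewrite mulr1 big1 ?addr0 => [|t nt]; last first.
  rewrite (_ : (w == tval t) = false) ?mulr0 //; apply/negbTE.
  by apply: contra nt => /eqP E; apply/eqP/val_inj.
rewrite big1 ?addr0 // => n nn; rewrite big1 // => t _.
have [E|] := eqVneq w (tval t); last by rewrite mulr0.
by case/eqP: nn; apply: val_inj; rewrite /= E size_tuple.
Qed.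

Fact lin_ext_linear (F : word -> series k) : linear (lin_ext F).
Proof.
move=> a f g; apply: seriesP => w /=.
rewrite mulr_sumr -big_split; apply: eq_bigr => n _ /=.
rewrite mulr_sumr -big_split; apply: eq_bigr => v _ /=.
by rewrite mulrDl mulrA.
Qed.

Lemma lin_ext_const (F : word -> series k) a :
  F [::] = 0 -> lin_ext F a%:A = 0.
Proof.
move=> F0; apply: seriesP => w /=; rewrite big1 // => n _.
rewrite big1 // => v _; have [->|] := eqVneq (tval v) [::].
  by rewrite F0 mulr0.
by rewrite mulr0 mul0r.
Qed.

Lemma coef_lin_ext_letterM (F : word -> series k) i f w :
  lin_ext F (X i * f) w =
  \sum_(n < (size w).+1) \sum_(v : n.-tuple bool) f v * F (i :: v) w.
Proof.
transitivity (\sum_(n < (size w).+2) \sum_(v : n.-tuple bool)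
  coef (X i * f) v * F v w) => //.
rewrite big_ord_recl [X in X + _]big1 ?add0r => [|v _]; last first.
  by rewrite [tval v](size0nil (size_tuple v)) coef_letterM mul0r.
apply: eq_bigr => n _.
rewrite (@sum_tupleS n (fun v => coef (X i * f) v * F v w)).
have E j : \sum_(v : n.-tuple bool) coef (X i * f) (j :: v) * F (j :: v) w
    = (i == j)%:R * \sum_(v : n.-tuple bool) f v * F (i :: v) w.
  rewrite mulr_sumr; apply: eq_bigr => v _; rewrite coef_letterM -mulrA.
  by case: eqP => [->|]; rewrite ?mul0r.
by rewrite !E -mulrDl -natrD; case: (i); rewrite mul1r.
Qed.

Lemma coefM_mono h f N w : (size w < N)%N ->
  \sum_(n < N) \sum_(v : n.-tuple bool) f v * coef (h * mono k v) w = coef (h * f) w.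
Proof.
move=> ltwN /=.
under eq_bigr => n _ do under eq_bigr => v _ do rewrite mulr_sumr.
under eq_bigr => n _ do rewrite exchange_big /=.
rewrite exchange_big; apply: eq_bigr => j _ /=.
rewrite -(@sum_words_delta N f (drop j w)).
  rewrite mulr_sumr; apply: eq_bigr => n _; rewrite mulr_sumr.
  by apply: eq_bigr => v _; rewrite mulrCA.
by rewrite (leq_ltn_trans _ ltwN) // size_drop leq_subr.
Qed.

(** Both extensions that matter have this form: for a derivation, a leading
    letter is either kept or replaced by h; for mu, it is either kept or merged
    with the letter that follows. *)
Lemma lin_ext_letterM (F : word -> series k) i f (h : series k) e :
  (forall w, F (i :: w) = h * mono k w + X i * F w + e *: (X i * dR i (mono k w))) ->
  lin_ext F (X i * f) = h * f + X i * lin_ext F f + e *: (X i * dR i f).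
Proof.
move=> FE; apply: seriesP => w; rewrite coef_lin_ext_letterM.
(* W G is the sum of f(v) G(v) over all words v of length at most that of w. *)
pose W G : k := \sum_(n < (size w).+1) \sum_(v : n.-tuple bool) f v * G (v : word).
have WD G1 G2 : W (fun v => G1 v + G2 v) = W G1 + W G2.
  rewrite /W -big_split; apply: eq_bigr => n _ /=.
  by rewrite -big_split; apply: eq_bigr => v _ /=; rewrite mulrDr.
have WZ a G : W (fun v => a * G v) = a * W G.
  rewrite mulr_sumr; apply: eq_bigr => n _.
  by rewrite mulr_sumr; apply: eq_bigr => v _; rewrite mulrCA.
have WE G1 G2 : G1 =1 G2 -> W G1 = W G2.
  by move=> E; apply: eq_bigr => n _; apply: eq_bigr => v _; rewrite E.
transitivity (W (fun v => coef (h * mono k v) w + coef (X i * F v) w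
                           + e * coef (X i * dR i (mono k v)) w)).
  apply: (WE (fun v => F (i :: v) w)) => v; by rewrite FE.
rewrite !WD WZ !coefD coefZ; congr (_ + _ + e * _); first exact: coefM_mono.
  case: w @W WD WZ WE => [|j w] W WD WZ WE.
    rewrite coef_letterM -[RHS](mul0r (W (fun=> 0))) -WZ.
    by apply: WE => v; rewrite coef_letterM mul0r.
  rewrite coef_letterM -[lin_ext F f w]/(W (fun v => F v w)) -WZ.
  by apply: WE => v; rewrite coef_letterM.
case: w @W WD WZ WE => [|j w] W WD WZ WE.
  rewrite coef_letterM -[RHS](mul0r (W (fun=> 0))) -WZ.
  by apply: WE => v; rewrite coef_letterM mul0r.
have E : W (fun v => (i :: w == v)%:R) = dR i f w by exact: sum_words_delta.
rewrite coef_letterM -E -WZ; apply: WE => v.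
by rewrite coef_letterM.
Qed.

HB.instance Definition _ F :=
  GRing.isLinear.Build k (series k) (series k) *:%R (lin_ext F) (lin_ext_linear F).
HB.instance Definition _ := GRing.Linear.copy (@mu k) (lin_ext (@mu_word k)).
HB.instance Definition _ psi :=
  GRing.Linear.copy (ider psi) (lin_ext (ider_word psi)).

Lemma dR_linear i : linear (@dR k i).
Proof. by move=> a f g; apply: seriesP. Qed.
Lemma dL_linear i : linear (@dL k i).
Proof. by move=> a f g; apply: seriesP. Qed.
HB.instance Definition _ i :=
  GRing.isLinear.Build k (series k) (series k) *:%R (@dR k i) (dR_linear i).
HB.instance Definition _ i :=
  GRing.isLinear.Build k (series k) (series k) *:%R (@dL k i) (dL_linear i).

Lemma mono_cons i w : mono k (i :: w) = X i * mono k w.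
Proof.
apply: seriesP => -[|j v]; rewrite coef_letterM //= eqseq_cons eq_sym.
by case: eqP; rewrite ?mul1r ?mul0r.
Qed.

Lemma mono_nil : mono k [::] = 1. Proof. by []. Qed.

(** The last term merges the leading letter with the next one when they agree. *)
Lemma mu_letterM i f : mu (X i * f) = X i * mu f + X i * dR i f.
Proof.
rewrite /mu (@lin_ext_letterM (@mu_word k) i f 0 1) ?mul0r ?add0r ?scale1r //.
move=> [|j w]; rewrite mul0r add0r scale1r /mu_word.
  by rewrite !big_ord0 (_ : dR _ _ = 0) ?mulr0 ?addr0 //; apply: seriesP.
rewrite [(size _).-1]/= big_ord_recl /= drop0 mono_nil mul1r addrC.
congr (_ + _).
  rewrite mulr_sumr; apply: eq_bigr => l _.
  by rewrite mono_cons -!mulrA.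
rewrite /odot; case: eqP => [->|ne].
  by rewrite scale1r; congr (_ * _); apply: seriesP => v /=; rewrite eqseq_cons eqxx.
rewrite scale0r mul0r (_ : dR _ _ = 0) ?mulr0 //.
by apply: seriesP => v /=; rewrite eqseq_cons; case: eqP.
Qed.

Lemma mu_const a : mu (a%:A : series k) = 0.
Proof. by apply: lin_ext_const; rewrite /mu_word big_ord0. Qed.

Lemma ider_letterM psi i f :
  ider psi (X i * f) = ider_letter psi i * f + X i * ider psi f.
Proof.
rewrite /ider (@lin_ext_letterM _ i f (ider_letter psi i) 0) ?scale0r ?addr0 //.
move=> w; rewrite scale0r addr0 /ider_word /= big_ord_recl /= drop0 mono_nil.
rewrite mul1r mulr_sumr; congr (_ + _); apply: eq_bigr => l _.
by rewrite mono_cons -!mulrA.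
Qed.

Lemma ider_const psi a : ider psi a%:A = 0.
Proof. by apply: lin_ext_const; rewrite /ider_word big_ord0. Qed.

(** Each coefficient of L f at a nonempty word is a coefficient, at a shorter
    word, of L at some d^R_i(f): no continuity of L has to be assumed. *)
Lemma letter_linear_eq0 (L : series k -> series k) :
    (forall f g, L (f + g) = L f + L g) -> (forall a, L a%:A = 0) ->
    (forall i f, L (X i * f) = X i * L f) ->
  forall f, L f = 0.
Proof.
move=> LD LA LX f; apply: seriesP => w; elim: w f => [|i w IHw] f;
  rewrite (dR_decomp f) !LD LA !LX add0r coefD !coef_letterM ?addr0 //.
by rewrite !IHw !mulr0 addr0.
Qed.

(** * Product rules *)

Lemma dRM i f g : dR i (f * g) = eps f *: dR i g + dR i f * g.
Proof. by apply: seriesP => w; exact: smul_cons. Qed.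

Lemma dLM i f g : dL i (f * g) = f * dL i g + eps g *: dL i f.
Proof.
apply: seriesP => w /=; rewrite size_rcons big_ord_recr /=.
have -> : take (size w).+1 (rcons w i) = rcons w i.
  by rewrite take_oversize ?size_rcons.
have -> : drop (size w).+1 (rcons w i) = [::].
  by rewrite drop_oversize ?size_rcons.
rewrite mulrC; congr (_ + _); apply: eq_bigr => l _.
have le_lw : (l <= size w)%N by rewrite -ltnS.
by rewrite drop_rcons // -cats1 takel_cat.
Qed.

Lemma epsM f g : eps (f * g) = eps f * eps g.
Proof. by rewrite /eps /= big_ord1. Qed.
Lemma eps_letter i : eps (X i) = 0. Proof. by []. Qed.

Lemma dR_letter i j : dR i (X j) = (i == j)%:R%:A.
Proof.
apply: seriesP => w /=; rewrite eqseq_cons.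
by case: (i == j); rewrite ?mul1r ?mul0r.
Qed.

Lemma dL_letter i j : dL i (X j) = (i == j)%:R%:A.
Proof.
apply: seriesP => w /=; case: w => [|l w] /=.
  by rewrite eqseq_cons; case: (i == j); rewrite ?mul1r ?mul0r.
by rewrite eqseq_cons; case: w => [|? ?] /=; rewrite andbF mulr0.
Qed.

Lemma mu1 : mu (1 : series k) = 0.
Proof. by rewrite -[RHS](mu_const 1) scale1r. Qed.
Lemma ider1 psi : ider psi 1 = 0.
Proof. by rewrite -[RHS](ider_const psi 1) scale1r. Qed.

Lemma dR_const i a : dR i (a%:A : series k) = 0.
Proof. by apply: seriesP => w /=; rewrite mulr0. Qed.
Lemma dL_const i a : dL i (a%:A : series k) = 0.
Proof. by apply: seriesP => -[|j w] /=; rewrite mulr0. Qed.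

Lemma mu_letter i : mu (X i) = 0.
Proof.
by rewrite -[X i]mulr1 mu_letterM mu1 mulr0 add0r.
Qed.

Lemma ider_letterE psi i : ider psi (X i) = ider_letter psi i.
Proof.
by rewrite -[X i]mulr1 ider_letterM ider1 mulr0 addr0 mulr1.
Qed.
Lemma ider_X0 psi : ider psi X0 = 0. Proof. exact: ider_letterE. Qed.
Lemma ider_X1 psi : ider psi X1 = lie X1 psi. Proof. exact: ider_letterE. Qed.

Lemma iderM psi f g : ider psi (f * g) = ider psi f * g + f * ider psi g.
Proof.
apply/eqP; rewrite -subr_eq0; apply/eqP; move: f.
apply: letter_linear_eq0 => [f f'|a|i f].
- rewrite mulrDl !linearD /=; nc_ring.
- rewrite -!scalerAl !mul1r !ider_const linearZ /= mul0r add0r; exact: subrr.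
- rewrite -mulrA !ider_letterM; nc_ring.
Qed.

(** Besides the Leibniz terms, the last letter of a word of f can merge with an
    equal first letter of a word of g. *)
Lemma muM f g : mu (f * g) = mu f * g + f * mu g
  + dL false f * X0 * dR false g + dL true f * X1 * dR true g.
Proof.
apply/eqP; rewrite -subr_eq0; apply/eqP; move: f.
apply: letter_linear_eq0 => [f f'|a|i f].
- rewrite mulrDl !linearD /=; nc_ring.
- rewrite -!scalerAl !mul1r !mu_const linearZ /= !dL_const.
  by rewrite !mul0r add0r !addr0 subrr.
- rewrite -mulrA !mu_letterM !dLM !dRM !dL_letter; case: i => /=;
  rewrite scale1r scale0r; nc_ring.
Qed.

Lemma dR_mu i f : dR i (mu f) = mu (dR i f) + dR i (dR i f).
Proof.
rewrite {1}(dR_decomp f) !linearD /= mu_const !mu_letterM linear0 add0r.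
rewrite !linearD /= !dRM !eps_letter !scale0r !add0r !dR_letter.
by case: i => /=; rewrite !scale1r !scale0r; nc_ring.
Qed.

Lemma eps_lie f g : eps (lie f g) = 0.
Proof. by rewrite /lie -[LHS]/(eps (f * g) - eps (g * f)) !epsM mulrC subrr. Qed.

Lemma dR_lie i f g : eps f = 0 -> eps g = 0 ->
  dR i (lie f g) = dR i f * g - dR i g * f.
Proof. by move=> f0 g0; rewrite linearB /= !dRM f0 g0 !scale0r !add0r. Qed.

Lemma dL_lie i f g : eps f = 0 -> eps g = 0 ->
  dL i (lie f g) = f * dL i g - g * dL i f.
Proof. by move=> f0 g0; rewrite linearB /= !dLM f0 g0 !scale0r !addr0. Qed.

Lemma ider_lie psi f g :
  ider psi (lie f g) = lie (ider psi f) g + lie f (ider psi g).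
Proof. by rewrite linearB /= !iderM /lie; nc_ring. Qed.

Lemma dR_ider psi i f :
  dR i (ider psi f) = ider psi (dR i f) + dR i (lie X1 psi) * dR true f.
Proof.
(* The bracket is kept as one atom L, which additivity cannot split. *)
have [L EL] : exists L, lie X1 psi = L by exists (lie X1 psi).
have L0 : eps L = 0 by rewrite -EL eps_lie.
rewrite EL.
rewrite {1}(dR_decomp f) !linearD /= ider_const !ider_letterM linear0 add0r.
rewrite /ider_letter EL.
rewrite mul0r add0r !linearD /= !dRM !eps_letter L0 !scale0r !add0r !dR_letter.
by case: i => /=; rewrite !scale1r !scale0r; nc_ring.
Qed.

Lemma dL_ider psi i f :
  dL i (ider psi f) = ider psi (dL i f) + dL true f * dL i (lie X1 psi).
Proof.
(* The bracket is kept as one atom L, which additivity cannot split. *)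
have [L EL] : exists L, lie X1 psi = L by exists (lie X1 psi).
have L0 : eps L = 0 by rewrite -EL eps_lie.
rewrite EL.
rewrite {1}(dL_decomp f) !linearD /= ider_const !iderM !ider_letterE linear0 add0r.
rewrite /ider_letter EL.
rewrite mulr0 addr0 !linearD /= !dLM !eps_letter L0 !scale0r !addr0 !dL_letter.
by case: i => /=; rewrite !scale1r !scale0r; nc_ring.
Qed.

(** * The coaction against the derivation attached to a Lie series *)

(** In the application, R0 and R1 are r(x_0) and r(x_1) for an even series r,
    and the last hypothesis comes from the antipode. *)
Section Commutation.
Variables (psi R0 R1 : series k).
Hypothesis eps_psi : eps psi = 0.
Hypothesis mu_psi : mu psi = R0 - R1 - dL false psi - dR true psi.
Hypothesis R0C : R0 * X0 = X0 * R0.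
Hypothesis R1C : R1 * X1 = X1 * R1.
Hypothesis dLR : dL false psi + dR true psi = dR false psi + dL true psi.

(** The right-hand side inserts one series after the letter x_1 and another one
    before it; the terms in R1 cancel since R1 commutes with x_1. *)
Lemma mu_lie_X1 : mu (lie X1 psi) =
  X1 * (R0 - dL false psi) + (dR false psi - R0) * X1.
Proof.
have dLRE : dR true psi = dR false psi + dL true psi - dL false psi.
  by rewrite -dLR addrC addKr.
rewrite /lie linearB /= !muM mu_letter !dR_letter !dL_letter mu_psi dLRE.
rewrite !scale1r !scale0r; nc_expand; rewrite R1C; nc_ring.
Qed.

(** The insertions inside words telescope: [R0] enters after each x_1 that
    precedes a block of letters x_0 and leaves at the end of that block.  What
    is left is a commutator with R0 and one correction at each end of a word. *)
Lemma mu_ider f : mu (ider psi f) = ider psi (mu f) + lie f R0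
  + dR false psi * X1 * dR true f - dL true f * X1 * dL false psi.
Proof.
apply/eqP; rewrite -subr_eq0; apply/eqP; move: f.
apply: letter_linear_eq0 => [f f'|a|i f].
- rewrite /lie !linearD /=; nc_ring.
- rewrite ider_const mu_const !linear0 dR_const dL_const /lie; nc_ring.
have Xf : X0 * dR false f = f - eps f *: 1 - X1 * dR true f.
  rewrite {2}(dR_decomp f); nc_ring.
rewrite ider_letterM mu_letterM; case: i => /=.
- rewrite linearD /= mu_letterM [in LHS]muM mu_lie_X1.
  rewrite !dL_lie ?eps_letter // !dL_letter !dR_ider dR_lie // !dR_letter.
  rewrite !linearD /= !ider_letterM /= !dRM !dLM !dL_letter !dR_letter eps_letter.
  rewrite !scale1r !scale0r.
  (* The products with x_0 are the only relation between the monomials. *)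
  have {}Xf h : h * X0 * dR false f = h * f - eps f *: h - h * X1 * dR true f.
    by rewrite -mulrA Xf; nc_ring.
  have dLRE : dR true psi = dR false psi + dL true psi - dL false psi.
    by rewrite -dLR addrC addKr.
  rewrite /lie; nc_expand; rewrite !Xf dLRE; nc_ring.
- rewrite mul0r add0r mu_letterM dR_ider dR_lie // !dR_letter.
  rewrite !linearD /= !ider_letterM /= !dRM !dLM !dL_letter !dR_letter.
  rewrite eps_letter /= !scale0r /lie; nc_expand; rewrite R0C; nc_ring.
Qed.

End Commutation.

(** * Power series in one letter *)

Lemma letterX n i : X i ^+ n = mono k (nseq n i).
Proof. by elim: n => // n IHn; rewrite exprS IHn mono_cons. Qed.

Lemma coef_ps_letter c i w :
  ps_eval c (X i) w = if w == nseq (size w) i then c (size w) else 0.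
Proof.
have E n : coef (X i ^+ n) w = (w == nseq n i)%:R by rewrite letterX.
transitivity (\sum_(n < (size w).+1) c n * (w == nseq n i)%:R).
  by apply: eq_bigr => n _; rewrite -E.
rewrite (bigD1 ord_max) //= big1 ?addr0 => [|n nn].
  by case: eqP => _; rewrite ?mulr1 ?mulr0.
case: eqP => [Ew|_]; last by rewrite mulr0.
by case/eqP: nn; apply: val_inj => /=; have := congr1 size Ew; rewrite size_nseq.
Qed.

Lemma ps_letter_rec c i :
  ps_eval c (X i) = (c 0)%:A + X i * ps_eval (fun n => c n.+1) (X i).
Proof.
apply: seriesP => -[|j w]; coef_push; rewrite coef_letterM !coef_ps_letter.
  by rewrite /= mulr1 addr0.
rewrite -[coef 1 _]/(0 : k) mulr0 add0r eqseq_cons (eq_sym j).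
by case: eqP => /=; rewrite ?mul1r ?mul0r.
Qed.

(** The analogue of [letter_linear_eq0] for a family of series that depends on
    the coefficients c and is compatible with their shift. *)
Lemma shift_rec_eq0 (L : (nat -> k) -> series k) i :
  (forall c, L c = X i * L (fun n => c n.+1)) -> forall c, L c = 0.
Proof.
move=> LE c; apply: seriesP => w; elim: w c => [|j w IHw] c.
  by rewrite LE coef_letterM.
by rewrite LE coef_letterM IHw mulr0.
Qed.

Lemma ps_letterC c i : ps_eval c (X i) * X i = X i * ps_eval c (X i).
Proof.
apply/eqP; rewrite -subr_eq0; apply/eqP; move: c.
apply: (@shift_rec_eq0 _ i) => c.
by rewrite (ps_letter_rec c) mulrDl mulrDr; nc_ring.
Qed.

Lemma ider_ps_X0 psi c : ider psi (ps_eval c X0) = 0.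
Proof.
move: c; apply: (@shift_rec_eq0 _ false) => c.
by rewrite (ps_letter_rec c) linearD /= ider_const ider_letterM mul0r !add0r.
Qed.

Lemma ider_ps_X1 psi c : ider psi (ps_eval c X1) = lie (ps_eval c X1) psi.
Proof.
apply/eqP; rewrite -subr_eq0; apply/eqP; move: c.
apply: (@shift_rec_eq0 _ true) => c.
rewrite (ps_letter_rec c) linearD /= ider_const ider_letterM /= /lie.
nc_ring.
Qed.

(** * The coaction of an Ihara bracket *)

(** In the corrections of [mu_ider] at the ends of words, those at the right end
    cancel against d^L_0, those at the left end combine with d^R_1 and with the
    merging terms of [psi1, psi2] into multiples of
    d^L_0 + d^R_1 - d^R_0 - d^L_1, which vanish.  The commutators with the power
    series cancel among themselves. *)
Lemma mu_ihara psi1 psi2 A0 A1 B0 B1 :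
    eps psi1 = 0 -> eps psi2 = 0 ->
    mu psi1 = A0 - A1 - dL false psi1 - dR true psi1 ->
    mu psi2 = B0 - B1 - dL false psi2 - dR true psi2 ->
    A0 * X0 = X0 * A0 -> A1 * X1 = X1 * A1 ->
    B0 * X0 = X0 * B0 -> B1 * X1 = X1 * B1 ->
    dL false psi1 + dR true psi1 = dR false psi1 + dL true psi1 ->
    dL false psi2 + dR true psi2 = dR false psi2 + dL true psi2 ->
    ider psi2 A0 = 0 -> ider psi1 B0 = 0 ->
    ider psi2 A1 = lie A1 psi2 -> ider psi1 B1 = lie B1 psi1 ->
  mu (ihara psi1 psi2) = - dL false (ihara psi1 psi2) - dR true (ihara psi1 psi2).
Proof.
move=> e1 e2 mu1 mu2 A0C A1C B0C B1C LR1 LR2 dA0 dB0 dA1 dB1.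
(* These two rules eliminate the only relations between the monomials. *)
have Xf f h : eps f = 0 -> h * X0 * dR false f = h * f - h * X1 * dR true f.
  move=> e; rewrite {2}(dR_decomp f) e; nc_expand; nc_ring.
have LRE psi : dL false psi + dR true psi = dR false psi + dL true psi ->
    dR false psi = dL false psi + dR true psi - dL true psi.
  by move->; rewrite addrK.
have muD f g : mu (f - g) = mu f - mu g by rewrite linearB.
have dLD i f g : dL i (f - g) = dL i f - dL i g by rewrite linearB.
have dRD i f g : dR i (f - g) = dR i f - dR i g by rewrite linearB.
have diD psi f g : ider psi (f - g) = ider psi f - ider psi g by rewrite linearB.
rewrite /ihara !muD !dLD !dRD.
rewrite (mu_ider e2 mu2 B0C B1C LR2) (mu_ider e1 mu1 A0C A1C LR1).
rewrite !muM mu1 mu2 !diD dA0 dB0 dA1 dB1 !dL_ider !dR_ider.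
rewrite !(dL_lie, dR_lie) // !dLM !dRM e1 e2 !dR_letter !dL_letter /= !scale1r !scale0r.
rewrite !Xf // (LRE _ LR1) (LRE _ LR2) /lie.
nc_ring.
Qed.

(** * The antipode *)

Definition antipode f : series k :=
  Series (fun w => (-1) ^+ size w * f (rev w)).

Lemma antipode_linear : linear antipode.
Proof. by move=> a f g; apply: seriesP => w /=; ring. Qed.
HB.instance Definition _ :=
  GRing.isLinear.Build k (series k) (series k) *:%R antipode antipode_linear.

Lemma antipode_letter i : antipode (X i) = - X i.
Proof.
apply: seriesP => w /=; rewrite -(inj_eq (can_inj revK)) revK.
by case: eqP => [->|]; rewrite ?expr1 ?mulN1r // mulr0 oppr0.
Qed.

Lemma antipodeM f g : antipode (f * g) = antipode g * antipode f.
Proof.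
apply: seriesP => w /=; rewrite size_rev mulr_sumr.
rewrite (reindex_inj rev_ord_inj); apply: eq_bigr => l _ /=.
have le_lw : (l <= size w)%N by rewrite -ltnS.
rewrite subSS size_takel // size_drop take_rev drop_rev subKn //.
by rewrite mulrACA -exprD subnKC // (mulrC (g _)).
Qed.

Lemma antipode_dL i f : antipode (dL i f) = - dR i (antipode f).
Proof. by apply: seriesP => w /=; rewrite rev_cons exprS; ring. Qed.

Lemma antipode_dR i f : antipode (dR i f) = - dL i (antipode f).
Proof. by apply: seriesP => w /=; rewrite rev_rcons size_rcons exprS; ring. Qed.

Lemma mu_nil f : mu f [::] = 0.
Proof.
have -> : mu f = X0 * (mu (dR false f) + dR false (dR false f))
    + X1 * (mu (dR true f) + dR true (dR true f)).
  by rewrite {1}(dR_decomp f) !linearD /= !mu_letterM mu_const add0r; nc_ring.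
by coef_push; rewrite !coef_letterM !addr0.
Qed.

(** So the coefficient of a word w in mu(f) is the sum of the coefficients in f
    of the words obtained by doubling one letter of w. *)
Lemma mu_consE i w f : mu f (i :: w) = mu (dR i f) w + f [:: i, i & w].
Proof. by rewrite -[LHS]/(dR i (mu f) w) dR_mu; coef_push. Qed.

Lemma dL_mu i f : dL i (mu f) = mu (dL i f) + dL i (dL i f).
Proof.
apply: seriesP => w; coef_push; elim: w f => [|j w IHw] f.
  by rewrite -[LHS]/(mu f [:: i]) mu_consE !mu_nil.
rewrite -[LHS]/(mu f (j :: rcons w i)) !mu_consE.
by rewrite -[mu (dR j f) _]/(dL i (mu (dR j f)) w) IHw addrAC.
Qed.

(** Reversing a word exchanges its pairs of consecutive letters; the sign
    comes from the letter lost in a merging. *)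
Lemma antipode_mu f : antipode (mu f) = - mu (antipode f).
Proof.
apply: seriesP => w; coef_push; elim: w f => [|i w IHw] f.
  by rewrite -[LHS]/(1 * mu f [::]) !mu_nil mulr0 oppr0.
rewrite mu_consE.
have -> : antipode (mu f) (i :: w) = - antipode (dL i (mu f)) w.
  by rewrite antipode_dL; coef_push; rewrite opprK.
have SD g h : antipode (g + h) = antipode g + antipode h := linearD _ g h.
have muN g : mu (- g) = - mu g := linearN _ g.
rewrite dL_mu SD; coef_push; rewrite IHw.
have -> : antipode (dL i (dL i f)) w = antipode f [:: i, i & w].
  rewrite antipode_dL; coef_push.
  by rewrite -[RHS]opprK -[in RHS]mulN1r /= !exprS !rev_cons; ring.
by rewrite antipode_dL muN; coef_push; ring.
Qed.

Lemma lie_poly_antipode f : lie_poly f -> antipode f = - f.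
Proof.
elim=> [i|a {}f g _ IHf _ IHg|{}f g _ IHf _ IHg].
- exact: antipode_letter.
- by rewrite linearD linearZ /= IHf IHg; nc_ring.
- by rewrite linearB /= !antipodeM IHf IHg /lie; nc_ring.
Qed.

Lemma coef_hcomp n f w : size w = n -> hcomp n f w = f w.
Proof. by move=> /= ->; rewrite eqxx. Qed.

Lemma lie_series_antipode psi : lie_series psi -> antipode psi = - psi.
Proof.
move=> Lpsi; apply: seriesP => w; coef_push.
have /(congr1 (fun f => coef f w)) := lie_poly_antipode (Lpsi (size w)).
by coef_push; rewrite /= size_rev eqxx.
Qed.

Lemma lie_series_rev psi w : lie_series psi ->
  psi (rev w) = (-1) ^+ (size w).+1 * psi w.
Proof.
move/lie_series_antipode/(congr1 (fun f => coef f w)); coef_push => /= E.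
rewrite exprS mulN1r mulNr -mulrN -E mulrA -exprD addnn.
by rewrite -signr_odd odd_double mul1r.
Qed.

(** * Vanishing of the even weight coefficients in depth one *)

Lemma coefM_nseq f g n i : (f * g) (nseq n i) =
  \sum_(l < n.+1) f (nseq l i) * g (nseq (n - l) i).
Proof.
rewrite /= size_nseq; apply: eq_bigr => l _.
by rewrite take_nseq ?drop_nseq // -ltnS.
Qed.

Lemma lie_poly_eps f : lie_poly f -> eps f = 0.
Proof.
elim=> [i|a {}f g _ IHf _ IHg|{}f g _ _ _ _] //; last exact: eps_lie.
by rewrite -[LHS]/(a * eps f + eps g) IHf IHg mulr0 addr0.
Qed.

Lemma coefM_X0 f h m : (forall l, l != 1%N -> f (nseq l false) = 0) ->
  (f * h) (nseq m.+1 false) = f [:: false] * h (nseq m false).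
Proof.
move=> f0; rewrite coefM_nseq.
rewrite (bigD1 (inord 1)) //= inordK // subn1 /= big1 ?addr0 // => l nl.
rewrite f0 ?mul0r //; apply: contra nl => /eqP El.
by apply/eqP/val_inj; rewrite /= inordK.
Qed.

(** The second part says that f vanishes on the shuffle of x_0 with
    x_0^m x_1, as a Lie polynomial does on proper shuffles; the first part is
    what the induction needs about powers of x_0. *)
Lemma lie_poly_shuffle_X0 f : lie_poly f ->
  (forall l, l != 1%N -> f (nseq l false) = 0) /\
  (forall m, dL true (dL false f) (nseq m false)
            = - (m.+1)%:R * dL true f (nseq m.+1 false)).
Proof.
elim=> [i|a {}f g _ [f0 IHf] _ [g0 IHg]|{}f g Lf [f0 IHf] Lg [g0 IHg]].
- split=> [[|[|l]] //= _|m].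
    by rewrite eqseq_cons andbF.
  rewrite dL_letter dL_const dL_letter; coef_push.
  by rewrite -[coef 1 (nseq _.+1 _)]/(0 : k) !mulr0.
- split=> [l l1|m]; first by coef_push; rewrite f0 // g0 // mulr0 addr0.
  have dLD i u v : dL i (a *: u + v) = a *: dL i u + dL i v := linearP _ a u v.
  by rewrite !dLD; coef_push; rewrite IHf IHg; ring.
have e0 := lie_poly_eps Lf; have e1 := lie_poly_eps Lg.
split=> [[|[|m]] // _|m].
- by rewrite -[LHS]/(eps (lie f g)) eps_lie.
- rewrite /lie; coef_push; rewrite !coefM_X0 //.
  case: m => [|m]; first by rewrite mulrC subrr.
  by rewrite f0 // g0 // !mulr0 subrr.
have dLB i u v : dL i (u - v) = dL i u - dL i v := linearB _ u v.
rewrite !dL_lie // dLB !dLM; coef_push.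
rewrite !coefM_X0 //.
case: m => [|m].
  have E (f1 f2 : series k) : eps f1 = 0 -> coef (f1 * f2) [::] = 0.
    by move=> e2; rewrite -[LHS]/(eps (f1 * f2)) epsM e2 mul0r.
  rewrite !E // -[eps (dL false f)]/(f [:: false]) -[eps (dL false g)]/(g [:: false]).
  by ring.
rewrite !coefM_X0 // IHf IHg.
rewrite -[eps (dL false f)]/(f [:: false]) -[eps (dL false g)]/(g [:: false]).
rewrite -[m.+2]addn1 natrD; ring.
Qed.

Lemma lie_series_shuffle_X0 psi m : lie_series psi ->
  psi (rcons (rcons (nseq m false) true) false)
    = - (m.+1)%:R * psi (rcons (nseq m.+1 false) true).
Proof.
move=> Lpsi; have [_ /(_ m)] := lie_poly_shuffle_X0 (Lpsi m.+2).
by rewrite /= !size_rcons /= !size_nseq eqxx.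
Qed.

Lemma coef_mu_X0nX1 f m : mu f (rcons (nseq m false) true)
  = m%:R * f (rcons (nseq m.+1 false) true)
    + f (rcons (rcons (nseq m false) true) true).
Proof.
elim: m f => [|m IHm] f; first by rewrite mu_consE mu_nil /= mul0r.
rewrite [rcons _ _]/= mu_consE IHm /= -[m.+1]addn1 natrD.
by ring.
Qed.

Lemma coef_mu_X0n f m : mu f (nseq m.+1 false) = (m.+1)%:R * f (nseq m.+2 false).
Proof.
elim: m f => [|m IHm] f; first by rewrite mu_consE mu_nil add0r mul1r.
rewrite [nseq _ _]/= mu_consE IHm /= -[m.+2]addn1 natrD.
by ring.
Qed.

Lemma coef_mu_X1X0n f m : mu f (true :: nseq m.+1 false)
  = (m.+1)%:R * f (true :: nseq m.+2 false) + f [:: true, true & nseq m.+1 false].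
Proof. by rewrite mu_consE coef_mu_X0n. Qed.

Lemma ps_evalN c f : ps_eval c (- f) = ps_eval (fun n => (-1) ^+ n * c n) f.
Proof.
apply: seriesP => w; apply: eq_bigr => n _ /=.
have -> : (- f) ^+ n = (-1) ^+ n *: f ^+ n.
  elim: (nat_of_ord n) => [|l IHl]; first by rewrite !expr0 scale1r.
  by rewrite !exprS IHl; nc_ring.
by coef_push; rewrite mulrCA mulrA.
Qed.

(** On words that contain both letters the series r does not contribute. *)
Lemma coef_mu_mixed psi w : reduced_coaction_eq psi -> has id w -> has negb w ->
  mu psi w = - psi (rcons w false) - psi (true :: w).
Proof.
move=> -> w1 w0; rewrite /r_series ps_evalN; coef_push; rewrite !coef_ps_letter.
have /negbTE -> : w != nseq (size w) true.
  by apply: contraL w0 => /eqP ->; rewrite has_nseq andbF.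
have /negbTE -> : w != nseq (size w) false.
  by apply: contraL w1 => /eqP ->; rewrite has_nseq andbF.
by rewrite oppr0 addr0 add0r.
Qed.

(** With c, A, P the coefficients of x_0^(m+1) x_1, x_0^m x_1 x_1 and
    x_1 x_0^m x_1, reversal in even length gives 2 P = 0 and the coefficients
    -c and -A of the reversed words.  The coaction equation gives A = c - P at
    x_0^m x_1 and (m + 1) c + 2 A = 0 at x_1 x_0^m, hence (m + 3) c = 0. *)
Lemma coef_X0nX1_eq0 psi m : [pchar k] =i pred0 -> lie_series psi ->
  reduced_coaction_eq psi -> ~~ odd m -> (0 < m)%N ->
  psi (rcons (nseq m.+1 false) true) = 0.
Proof.
(* From here on, m stands for the former m - 1, and is odd. *)
case: m => // m char0 Lpsi rc_psi; rewrite /= negbK => m_odd _.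
have rev_psi w : size w = m.+3 -> psi (rev w) = - psi w.
  move=> sw.
  by rewrite lie_series_rev // sw -signr_odd /= !negbK m_odd expr1 mulN1r.
pose c := psi (rcons (nseq m.+2 false) true).
pose A := psi (rcons (rcons (nseq m.+1 false) true) true).
pose P := psi (true :: rcons (nseq m.+1 false) true).
have Ec : psi (true :: nseq m.+2 false) = - c.
  by rewrite -rev_psi ?rev_rcons ?rev_nseq // size_rcons size_nseq.
have EA : psi [:: true, true & nseq m.+1 false] = - A.
  by rewrite -rev_psi ?rev_rcons ?rev_nseq // !size_rcons size_nseq.
have EP : P = - P.
  rewrite -rev_psi; last by rewrite /= size_rcons size_nseq.
  by rewrite rev_cons rev_rcons rev_nseq.
have ED := lie_series_shuffle_X0 m.+1 Lpsi; rewrite -/c in ED.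
have := @coef_mu_mixed psi (rcons (nseq m.+1 false) true) rc_psi.
rewrite !has_rcons orbT coef_mu_X0nX1 ED -/c -/A -/P => /(_ isT isT) E1.
have := @coef_mu_mixed psi (true :: nseq m.+1 false) rc_psi isT isT.
have -> : rcons (true :: nseq m.+1 false) false = true :: nseq m.+2 false.
  by rewrite -[nseq m.+2 _]/(nseq (1 + m.+1) false) addnC nseqD cats1.
rewrite coef_mu_X1X0n Ec EA => E2.
have EAc : A = c - P by apply: (addrI (m.+1%:R * c)); rewrite E1; ring.
rewrite EAc in E2.
have E : (m.+4)%:R * c = 0.
  transitivity (P + P + (- - c - - (c - P) - (m.+1%:R * - c - (c - P)))).
    by ring.
  by rewrite E2 subrr addr0 {1}EP addNr.
move/eqP: E; rewrite mulf_eq0 => /orP[|/eqP //].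
by rewrite (proj1 (pcharf0P k) char0).
Qed.

(** * The symmetry between first and last letters *)

(** Since mu anticommutes with the antipode, which acts as -1 on psi, the series
    mu(psi) is invariant under it, whereas d^L_i(psi) and d^R_i(psi) are
    exchanged. *)
Lemma dLR_sym psi R0 R1 : lie_series psi ->
  mu psi = R0 - R1 - dL false psi - dR true psi ->
  antipode R0 = R0 -> antipode R1 = R1 ->
  dL false psi + dR true psi = dR false psi + dL true psi.
Proof.
move=> Lpsi mu_psi SR0 SR1.
have Spsi := lie_series_antipode Lpsi.
have SB g h : antipode (g - h) = antipode g - antipode h := linearB _ g h.
have dLN i g : dL i (- g) = - dL i g := linearN _ g.
have dRN i g : dR i (- g) = - dR i g := linearN _ g.
have muN g : mu (- g) = - mu g := linearN _ g.
have : antipode (mu psi) = mu psi by rewrite antipode_mu Spsi muN opprK.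
rewrite mu_psi !SB SR0 SR1 antipode_dL antipode_dR Spsi dRN dLN !opprK => E.
apply/eqP; rewrite -subr_eq0 -(subr0 (_ - _)).
rewrite -(subrr (R0 - R1 - dL false psi - dR true psi)).
by rewrite -{1}E; apply/eqP; nc_ring.
Qed.

Lemma antipode_even_ps c i : (forall n, odd n -> c n = 0) ->
  antipode (ps_eval c (X i)) = ps_eval c (X i).
Proof.
move=> c_odd; apply: seriesP => w.
rewrite -[LHS]/((-1) ^+ size w * coef (ps_eval c (X i)) (rev w)) !coef_ps_letter.
rewrite size_rev -(inj_eq (can_inj revK)) revK rev_nseq -signr_odd.
case: eqP => _; last by rewrite mulr0.
by case: (boolP (odd _)) => [/c_odd ->|_]; rewrite ?mulr0 // mul1r.
Qed.

(** * Depth *)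

Definition depth_ge d f := forall w, (count id w < d)%N -> f w = 0.

Lemma depth_geM d e f g :
  depth_ge d f -> depth_ge e g -> depth_ge (d + e) (f * g).
Proof.
move=> Df Dg w ltw; apply: big1 => l _.
have [lt_d|le_d] := ltnP (count id (take l w)) d; first by rewrite Df // mul0r.
rewrite [g _]Dg ?mulr0 // -(ltn_add2l d) (leq_ltn_trans _ ltw) //.
by rewrite -[in leqRHS](cat_take_drop l w) count_cat leq_add2r.
Qed.

Lemma depth_ge_dR0 d f : depth_ge d f -> depth_ge d (dR false f).
Proof. by move=> Df w ltw; apply: Df. Qed.

Lemma depth_ge_dR1 d f : depth_ge d f -> depth_ge d.-1 (dR true f).
Proof. by case: d => // d Df w ltw; apply: Df. Qed.

Lemma depth_ge_lie d e f g :
  depth_ge d f -> depth_ge e g -> depth_ge (d + e) (lie f g).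
Proof.
move=> Df Dg w ltw; rewrite /lie; coef_push.
by rewrite (depth_geM Df Dg ltw) (depth_geM Dg Df) ?subrr // addnC.
Qed.

Lemma depth_ge_X1 : depth_ge 1 X1.
Proof. by case=> [|[] [|[] w]]. Qed.

Lemma ider_nil psi f : ider psi f [::] = 0.
Proof.
have -> : ider psi f = X0 * ider psi (dR false f)
    + lie X1 psi * dR true f + X1 * ider psi (dR true f).
  rewrite {1}(dR_decomp f) !linearD /= !ider_letterM ider_const /= add0r mul0r.
  by nc_ring.
coef_push; rewrite !coef_letterM.
by rewrite -[(lie X1 psi * _) _]/(eps (lie X1 psi * dR true f)) epsM eps_lie
           mul0r !addr0.
Qed.

Lemma ider_consE psi i w f : ider psi f (i :: w) =
  ider psi (dR i f) w + (dR i (lie X1 psi) * dR true f) w.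
Proof. by rewrite -[LHS]/(dR i (ider psi f) w) dR_ider; coef_push. Qed.

(** Replacing x_1 by [x_1, psi] keeps the letter x_1 and adds the depth of
    psi. *)
Lemma depth_ge_ider psi d f : depth_ge 1 psi -> depth_ge d f ->
  depth_ge d.+1 (ider psi f).
Proof.
move=> Dpsi Df w; have DL := depth_ge_lie depth_ge_X1 Dpsi.
elim: w d f Df => [|i w IHw] d f Df; first by rewrite ider_nil.
rewrite ider_consE; case: i => ltw.
  have {}ltw : (count id w < d)%N by [].
  rewrite (IHw _ _ (depth_ge_dR1 Df)); last by case: (d) ltw.
  rewrite add0r; apply: (depth_geM (depth_ge_dR1 DL) (depth_ge_dR1 Df)).
  by case: (d) ltw.
rewrite (IHw _ _ (depth_ge_dR0 Df)) // add0r.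
apply: (depth_geM (depth_ge_dR0 DL) (depth_ge_dR1 Df)).
by case: (d) ltw => [|e] ltw; rewrite // (leq_trans ltw).
Qed.

(** * Exchange of the two letters *)

Definition swap f : series k := Series (fun w => f (map negb w)).

Lemma swap_linear : linear swap.
Proof. by move=> a f g; apply: seriesP. Qed.
HB.instance Definition _ :=
  GRing.isLinear.Build k (series k) (series k) *:%R swap swap_linear.

Lemma swapM f g : swap (f * g) = swap f * swap g.
Proof.
apply: seriesP => w /=; rewrite size_map; apply: eq_bigr => l _.
by rewrite map_take map_drop.
Qed.

Lemma swap_letter i : swap (X i) = X (~~ i).
Proof.
apply: seriesP => -[|j [|j' w]] //=.
  by rewrite !eqseq_cons -(inj_eq negb_inj) negbK.
by rewrite !eqseq_cons !andbF.
Qed.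

Lemma swapK f : swap (swap f) = f.
Proof. by apply: seriesP => w /=; rewrite -map_comp (eq_map negbK) map_id. Qed.

Lemma swap_lie f g : swap (lie f g) = lie (swap f) (swap g).
Proof. by rewrite linearB /= !swapM. Qed.

(** Conjugating d_psi by the exchange gives the derivation that sends x_1 to 0 and
    x_0 to [x_0, swap psi] = -[x_0, psi]; so does d_psi + ad psi. *)
Lemma swap_ider psi f : swap psi = - psi ->
  swap (ider psi (swap f)) = ider psi f + lie psi f.
Proof.
move=> Spsi; apply/eqP; rewrite -subr_eq0; apply/eqP; move: f.
apply: letter_linear_eq0 => [f f'|a|i f].
- by rewrite /lie !linearD /=; nc_ring.
- have -> : swap a%:A = a%:A by apply: seriesP => -[].
  by rewrite !ider_const linear0 /lie; nc_ring.
rewrite swapM swap_letter !ider_letterM linearD /= !swapM swap_letter negbK.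
case: i => /=.
  by rewrite linear0 /lie; nc_ring.
by rewrite swap_lie swap_letter swapK Spsi /lie /=; nc_ring.
Qed.

Lemma swap_ihara psi1 psi2 : swap psi1 = - psi1 -> swap psi2 = - psi2 ->
  swap (ihara psi1 psi2) = - ihara psi1 psi2.
Proof.
move=> S1 S2.
have SB g h : swap (g - h) = swap g - swap h := linearB _ g h.
have dN g h : ider g (- h) = - ider g h := linearN _ h.
have E g h : swap g = - g -> swap h = - h ->
    swap (ider g h) = - ider g h - lie g h.
  have swapN f : swap (- f) = - swap f := linearN _ f.
  move=> Sg Sh; have := swap_ider h Sg; rewrite Sh dN swapN => E.
  by rewrite -opprD -E opprK.
rewrite /ihara !SB !swapM !E // S1 S2 /lie; nc_ring.
Qed.

(** * Stability of Lie series under the Ihara bracket *)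

Lemma lie_poly0 : lie_poly (0 : series k).
Proof.
have := lie_poly_lin (-1) (lie_poly_letter k false) (lie_poly_letter k false).
by rewrite scaleN1r addNr.
Qed.

Lemma lie_polyD f g : lie_poly f -> lie_poly g -> lie_poly (f + g).
Proof. by move=> Lf Lg; have := lie_poly_lin 1 Lf Lg; rewrite scale1r. Qed.

Lemma lie_polyB f g : lie_poly f -> lie_poly g -> lie_poly (f - g).
Proof. by move=> Lf Lg; have := lie_poly_lin (-1) Lg Lf; rewrite scaleN1r addrC. Qed.

Lemma lie_poly_sum n (F : 'I_n -> series k) :
  (forall l, lie_poly (F l)) -> lie_poly (\sum_l F l).
Proof.
by move=> LF; elim/big_rec: _ => [|l f _]; [apply: lie_poly0 | apply: lie_polyD].
Qed.

Lemma hcomp_linear n : linear (@hcomp k n).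
Proof.
by move=> a f g; apply: seriesP => w /=; case: eqP => // _; rewrite mulr0 addr0.
Qed.
HB.instance Definition _ n :=
  GRing.isLinear.Build k (series k) (series k) *:%R (@hcomp k n) (hcomp_linear n).

Lemma hcompM n f g :
  hcomp n (f * g) = \sum_(l < n.+1) hcomp l f * hcomp (n - l) g.
Proof.
apply: seriesP => w.
transitivity (\sum_(l < n.+1) coef (hcomp l f * hcomp (n - l) g) w); last first.
  by apply/esym/(big_morph (fun h => coef h w)).
rewrite [RHS]exchange_big /=; case: eqP => [<-|ne].
  apply: eq_bigr => l _; have le_l : (l <= size w)%N by rewrite -ltnS.
  rewrite (bigD1 l) //= size_takel // eqxx size_drop eqxx.
  rewrite big1 ?addr0 // => l' nl.
  case: eqP => [E|]; last by rewrite mul0r.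
  by case/eqP: nl; apply: val_inj; rewrite /= E.
rewrite big1 // => l _; have le_l : (l <= size w)%N by rewrite -ltnS.
rewrite big1 // => l' _; rewrite size_takel // size_drop.
case: eqP => [E|]; last by rewrite mul0r.
case: eqP => [E'|]; last by rewrite mulr0.
by case: ne; rewrite -(subnK le_l) E' E subnK // -ltnS.
Qed.

Lemma hcomp_lie n f g :
  hcomp n (lie f g) = \sum_(l < n.+1) lie (hcomp l f) (hcomp (n - l) g).
Proof.
rewrite linearB /= !hcompM [X in _ - X](reindex_inj rev_ord_inj) /=.
rewrite -sumrB; apply: eq_bigr => l _.
by rewrite subSS subKn // -ltnS.
Qed.

Lemma lie_poly_hcomp n f : lie_poly f -> lie_poly (hcomp n f).
Proof.
move=> Lf; elim: Lf n => [i|a {}f g _ IHf _ IHg|{}f g _ IHf _ IHg] n.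
- have [->|ne] := eqVneq n 1%N.
    suff -> : hcomp 1 (X i) = X i by apply: lie_poly_letter.
    by apply: seriesP => -[|j [|? ?]] //=; rewrite eqseq_cons andbF.
  suff -> : hcomp n (X i) = 0 by apply: lie_poly0.
  apply: seriesP => w /=; case: eqP => // E; case: eqP => // Ew.
  by case/eqP: ne; rewrite -E Ew.
- have -> : hcomp n (a *: f + g) = a *: hcomp n f + hcomp n g := linearP _ a f g.
  exact: lie_poly_lin.
- by rewrite hcomp_lie; apply: lie_poly_sum => l; apply: lie_poly_lie.
Qed.

Lemma lie_poly_ider psi f : lie_poly psi -> lie_poly f -> lie_poly (ider psi f).
Proof.
move=> Lpsi; elim=> [[]|a {}f g _ IHf _ IHg|{}f g Lf IHf Lg IHg].
- by rewrite ider_X1; apply: lie_poly_lie => //; apply: lie_poly_letter.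
- by rewrite ider_X0; apply: lie_poly0.
- have -> : ider psi (a *: f + g) = a *: ider psi f + ider psi g := linearP _ a f g.
  exact: lie_poly_lin.
- by rewrite ider_lie; apply: lie_polyD; apply: lie_poly_lie.
Qed.

(** Agreement up to degree n is what reduces statements on Lie series, which are
    infinite sums, to their truncations, which are Lie polynomials. *)
Definition agree n f g := forall w, (size w <= n)%N -> f w = g w.

Lemma agreeM n f f' g g' :
  agree n f f' -> agree n g g' -> agree n (f * g) (f' * g').
Proof.
move=> Af Ag w le_w; apply: eq_bigr => l _.
rewrite (Af (take l w)) ?(Ag (drop l w)) //.
  by rewrite (leq_trans _ le_w) // size_drop leq_subr.
by rewrite (leq_trans _ le_w) // size_take_min geq_minr.
Qed.

Lemma agree_lie n f f' g g' :
  agree n f f' -> agree n g g' -> agree n (lie f g) (lie f' g').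
Proof.
move=> Af Ag w le_w; rewrite /lie; coef_push.
by rewrite (agreeM Af Ag) // (agreeM Ag Af).
Qed.

Lemma agree_dR n i f f' : agree n.+1 f f' -> agree n (dR i f) (dR i f').
Proof. by move=> Af w le_w; apply: Af. Qed.

Lemma agreeW m n f f' : (m <= n)%N -> agree n f f' -> agree m f f'.
Proof. by move=> le_mn Af w le_w; apply/Af/leq_trans/le_mn. Qed.

Lemma agree_ider n psi psi' f f' :
  agree n psi psi' -> agree n f f' -> agree n (ider psi f) (ider psi' f').
Proof.
move=> Apsi Af w; elim: w n f f' Apsi Af => [|i w IHw] n f f' Apsi Af.
  by rewrite !ider_nil.
case: n Apsi Af => // n Apsi Af le_w; rewrite !ider_consE.
rewrite (IHw n _ (dR i f') (agreeW (leqnSn n) Apsi) (@agree_dR n i _ _ Af) le_w).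
congr (_ + _).
by apply: (@agreeM n) => //; apply: agree_dR => //; apply: agree_lie.
Qed.

Definition trunc n f := \sum_(l < n.+1) hcomp l f.

Lemma agree_trunc n f : agree n f (trunc n f).
Proof.
move=> w le_w; transitivity (\sum_(l < n.+1) hcomp l f w); last first.
  by apply/esym/(big_morph (fun h => coef h w)).
rewrite (bigD1 (Ordinal (n := n.+1) le_w)) //=.
rewrite eqxx big1 ?addr0 // => l nl; case: eqP => // E.
by case/eqP: nl; apply: val_inj; rewrite /= E.
Qed.

Lemma lie_series_ider psi f :
  lie_series psi -> lie_series f -> lie_series (ider psi f).
Proof.
move=> Lpsi Lf n.
have -> : hcomp n (ider psi f) = hcomp n (ider (trunc n psi) (trunc n f)).
  apply: seriesP => w; rewrite -[LHS]/(if size w == n then coef (ider psi f) w else 0).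
  rewrite -[RHS]/(if size w == n then coef (ider (trunc n psi) (trunc n f)) w else 0).
  case: eqP => // En.
  by apply: (@agree_ider n); rewrite ?En //; apply: agree_trunc.
by apply: lie_poly_hcomp; apply: lie_poly_ider; apply: lie_poly_sum => l.
Qed.

Lemma lie_series_lie f g : lie_series f -> lie_series g -> lie_series (lie f g).
Proof.
by move=> Lf Lg n; rewrite hcomp_lie; apply: lie_poly_sum => l; apply: lie_poly_lie.
Qed.

Lemma lie_series_ihara psi1 psi2 :
  lie_series psi1 -> lie_series psi2 -> lie_series (ihara psi1 psi2).
Proof.
move=> L1 L2 n.
have hB f g : hcomp n (f - g) = hcomp n f - hcomp n g := linearB _ f g.
rewrite /ihara 2!hB; apply: lie_polyB.
  by apply: lie_polyB; apply: lie_series_ider.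
exact: lie_series_lie.
Qed.

(** * The Jacobi identity *)

Lemma ider_linl a psi1 psi2 f :
  ider (a *: psi1 + psi2) f = a *: ider psi1 f + ider psi2 f.
Proof.
apply/eqP; rewrite -subr_eq0; apply/eqP; move: f.
apply: letter_linear_eq0 => [f f'|b|i f].
- by rewrite !linearD /=; nc_ring.
- by rewrite !ider_const; nc_ring.
by rewrite !ider_letterM /ider_letter /lie; case: i; nc_ring.
Qed.

(** Both sides are derivations, and they agree on the letters: this is where
    the three terms of the Ihara bracket come from. *)
Lemma ider_ihara psi1 psi2 f :
  ider (ihara psi1 psi2) f = ider psi2 (ider psi1 f) - ider psi1 (ider psi2 f).
Proof.
apply/eqP; rewrite -subr_eq0; apply/eqP; move: f.
apply: letter_linear_eq0 => [f f'|b|i f].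
- by rewrite !linearD /=; nc_ring.
- by rewrite !ider_const !linear0; nc_ring.
rewrite !ider_letterM !linearD /= !ider_letterM !iderM.
case: i => /=; last by rewrite !linear0; nc_ring.
by rewrite !ider_lie !ider_X1 /ihara /lie; nc_ring.
Qed.

Lemma ihara_jacobi u v t :
  ihara u (@ihara k v t) + ihara v (ihara t u) + ihara t (ihara u v) = 0.
Proof.
have dB f g h : ider f (g - h) = ider f g - ider f h := linearB _ g h.
have E f g h : ihara f (ihara g h) = ider h (ider g f) - ider g (ider h f)
   - (ider f (ider h g) - ider f (ider g h) - lie (ider f g) h - lie g (ider f h))
   - lie f (ider h g - ider g h - lie g h).
  by rewrite {1}/ihara ider_ihara /ihara !dB !iderM /lie; nc_ring.
rewrite !E /lie; nc_ring.
Qed.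

Lemma ihara_alt u : @ihara k u u = 0.
Proof. by rewrite /ihara /lie !subrr. Qed.

Lemma ihara_linl a u v t :
  @ihara k (a *: u + v) t = a *: ihara u t + ihara v t.
Proof. by rewrite /ihara ider_linl linearD linearZ /= /lie; nc_ring. Qed.

Lemma ihara_linr a u v t :
  @ihara k u (a *: v + t) = a *: ihara u v + ihara u t.
Proof. by rewrite /ihara ider_linl linearD linearZ /= /lie; nc_ring. Qed.

(** * The conditions defining rc_0 in terms of coefficients *)

Lemma lin_ext_reindex (F : word -> series k) (e : word -> k) (t : word -> word) :
    (forall v, size (t v) = size v) -> (forall w v, F w v = e w * (t v == w)%:R) ->
  forall f v, lin_ext F f v = f (t v) * e (t v).
Proof.
move=> tS FE f v; rewrite -(@sum_words_delta (size v).+2 (fun w => f w * e w)) ?tS //.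
by apply: eq_bigr => n _; apply: eq_bigr => w _; rewrite FE mulrA.
Qed.

Lemma prod_mono (P : pred bool) (s : bool -> bool) w :
  \prod_(i <- w) (if P i then X (s i) else 0) =
  (all P w)%:R *: mono k (map s w).
Proof.
elim: w => [|i w IHw]; first by rewrite big_nil scale1r.
rewrite big_cons IHw /=; case: (P i); last by rewrite mul0r scale0r.
by rewrite mono_cons -scalerAr.
Qed.

(** The four substitutions at hand send each letter to a letter or to 0; P
    selects the letters that survive and s says where they go. *)
Lemma coef_subst (P : pred bool) (s : bool -> bool) (f0 f1 : series k) psi w :
  involutive s -> f0 = (if P false then X (s false) else 0) ->
  f1 = (if P true then X (s true) else 0) ->
  subst psi f0 f1 w = if all P (map s w) then psi (map s w) else 0.
Proof.
move=> sK -> ->.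
rewrite /subst (@lin_ext_reindex _ (fun w => (all P w)%:R) (map s)) => [|v|{}w v].
- by case: all; rewrite ?mulr1 ?mulr0.
- exact: size_map.
have -> : \prod_(i <- w) (if i then if P true then X (s true) else 0
      else if P false then X (s false) else 0)
    = \prod_(i <- w) (if P i then X (s i) else 0).
  by apply: eq_bigr => -[].
rewrite prod_mono; coef_push; congr (_ * _).
rewrite -[mono _ _ _]/((v == map s w)%:R : k).
by rewrite -(inj_eq (inj_map (inv_inj sK))) -map_comp (eq_map sK) map_id.
Qed.

Lemma fr1P psi : fr1 psi <->
  [/\ lie_series psi, forall n, psi (nseq n false) = 0
    & forall n, psi (nseq n true) = 0].
Proof.
have E0 w : subst psi X0 0 w = if all negb w then psi w else 0.
  by rewrite (@coef_subst negb (fun i => i)) // map_id.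
have E1 w : subst psi 0 X1 w = if all id w then psi w else 0.
  by rewrite (@coef_subst (fun i => i) (fun i => i)) // map_id.
split=> -[Lpsi z0 z1]; split=> //.
- by move=> n; have := E0 (nseq n false); rewrite z0 all_nseq orbT => <-.
- by move=> n; have := E1 (nseq n true); rewrite z1 all_nseq orbT => <-.
- apply: seriesP => w; rewrite E0; case: ifP => // aw.
  have /all_pred1P -> : all (pred1 false) w by apply: sub_all aw => -[].
  exact: z0.
- apply: seriesP => w; rewrite E1; case: ifP => // aw.
  have /all_pred1P -> : all (pred1 true) w by apply: sub_all aw => -[].
  exact: z1.
Qed.

Lemma skewP psi : Defs.skew psi <-> fr1 psi /\ swap psi = - psi.
Proof.
have E0 : subst psi X0 X1 = psi.
  by apply: seriesP => w; rewrite (@coef_subst predT (fun i => i)) // map_id all_predT.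
have E1 : subst psi X1 X0 = swap psi.
  apply: seriesP => w; rewrite (@coef_subst predT negb) ?all_predT //.
  exact: negbK.
rewrite /Defs.skew E0 E1; split=> -[Fpsi Sw]; split=> //.
  by rewrite {2}Sw opprK.
by rewrite Sw opprK.
Qed.

Lemma lie2_coef0 psi : lie2_coef psi 0 <-> forall w, size w = 2%N -> psi w = 0.
Proof.
rewrite /lie2_coef scale0r; split=> [E w w2|E].
  by rewrite -(coef_hcomp psi w2) E.
by apply: seriesP => w /=; case: eqP => [/E|].
Qed.

(** Skewness and the vanishing on powers of a letter leave [x_0, x_1] as the only
    possible term of degree 2. *)
Lemma rc0P psi : rc0 psi <->
  [/\ fr1 psi, swap psi = - psi, reduced_coaction_eq psi
    & psi [:: false; true] = 0].
Proof.
split=> [[[/skewP[Fpsi Spsi] Rpsi] /lie2_coef0 E]|[Fpsi Spsi Rpsi E]].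
  by split=> //; apply: E.
split; first by split=> //; apply/skewP.
have /fr1P[_ z0 z1] := Fpsi.
apply/lie2_coef0 => -[|i [|j []]] // _; case: i j => -[].
- exact: (z1 2%N).
- have := congr1 (fun f => coef f [:: false; true]) Spsi.
  by coef_push; rewrite E oppr0.
- exact: E.
- exact: (z0 2%N).
Qed.

(** * The Lie algebra rc_0 *)

Lemma r_coef_odd psi n : [pchar k] =i pred0 -> rc0 psi -> odd n ->
  r_coef psi n = 0.
Proof.
move=> char0 /rc0P[/fr1P[Lpsi _ _] _ Rpsi E]; case: n => // -[//|n] n_odd.
by apply: coef_X0nX1_eq0.
Qed.

Lemma rc0_eps psi : rc0 psi -> eps psi = 0.
Proof. by case/rc0P => /fr1P[_ z _] _ _ _; apply: (z 0%N). Qed.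

Lemma rc0_mu psi : [pchar k] =i pred0 -> rc0 psi ->
  mu psi = ps_eval (r_coef psi) X0 - ps_eval (r_coef psi) X1
           - dL false psi - dR true psi.
Proof.
move=> char0 rpsi; have /rc0P[_ _ -> _] := rpsi.
rewrite /r_series ps_evalN.
have -> : ps_eval (fun n => (-1) ^+ n * r_coef psi n) X0 = ps_eval (r_coef psi) X0.
  apply: seriesP => w; rewrite !coef_ps_letter; case: eqP => // _.
  rewrite -signr_odd; case: (boolP (odd _)) => [wo|_]; last by rewrite mul1r.
  by rewrite r_coef_odd // mulr0.
by rewrite [- _ + _]addrC.
Qed.

Lemma rc0_dLR_sym psi : [pchar k] =i pred0 -> rc0 psi ->
  dL false psi + dR true psi = dR false psi + dL true psi.
Proof.
move=> char0 rpsi; have /rc0P[/fr1P[Lpsi _ _] _ _ _] := rpsi.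
apply: (dLR_sym Lpsi (rc0_mu char0 rpsi)); apply: antipode_even_ps => n;
  exact: r_coef_odd.
Qed.

Lemma rc0_mu_ihara psi1 psi2 : [pchar k] =i pred0 -> rc0 psi1 -> rc0 psi2 ->
  mu (ihara psi1 psi2) = - dL false (ihara psi1 psi2) - dR true (ihara psi1 psi2).
Proof.
move=> char0 r1 r2.
apply: (mu_ihara (rc0_eps r1) (rc0_eps r2) (rc0_mu char0 r1) (rc0_mu char0 r2));
  by [exact: ps_letterC | exact: rc0_dLR_sym | exact: ider_ps_X0 | exact: ider_ps_X1].
Qed.

Lemma depth_ge1 psi : (forall n, psi (nseq n false) = 0) -> depth_ge 1 psi.
Proof.
move=> z w; rewrite ltnS leqn0 -leqn0 leqNgt -has_count => nw.
have /all_pred1P -> : all (pred1 false) w; last exact: z.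
by rewrite (eq_all (a2 := predC id)) ?all_predC // => -[].
Qed.

Lemma depth_ge_ihara psi1 psi2 : depth_ge 1 psi1 -> depth_ge 1 psi2 ->
  depth_ge 2 (ihara psi1 psi2).
Proof.
move=> D1 D2 w ltw; rewrite /ihara; coef_push.
rewrite (depth_ge_ider D2 D1 ltw) (depth_ge_ider D1 D2 ltw).
by rewrite (depth_ge_lie D1 D2 ltw) !subr0.
Qed.

Lemma r_series_depth2 psi f : depth_ge 2 psi -> r_series psi f = 0.
Proof.
move=> D; apply: seriesP => w; apply: big1 => -[[|n] _] _ /=; first by rewrite mul0r.
rewrite -[X in psi X]/(rcons (nseq n.+1 false) true) D ?mul0r //.
by rewrite -cats1 count_cat count_nseq.
Qed.

Lemma rc0_ihara psi1 psi2 : [pchar k] =i pred0 -> rc0 psi1 -> rc0 psi2 ->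
  rc0 (ihara psi1 psi2).
Proof.
move=> char0 r1 r2.
have /rc0P[/fr1P[L1 z1 _] S1 _ _] := r1; have /rc0P[/fr1P[L2 z2 _] S2 _ _] := r2.
have D := depth_ge_ihara (depth_ge1 z1) (depth_ge1 z2).
have S12 := swap_ihara S1 S2.
have z n : ihara psi1 psi2 (nseq n false) = 0 by rewrite D // count_nseq.
apply/rc0P; split=> //; last by rewrite D.
  apply/fr1P; split=> // [|n]; first exact: lie_series_ihara.
  have := congr1 (fun f => coef f (nseq n false)) S12.
  by coef_push; rewrite z oppr0 /= map_nseq.
rewrite /reduced_coaction_eq rc0_mu_ihara // !r_series_depth2 //.
by rewrite oppr0 addr0 add0r.
Qed.

Lemma rc0_0 : rc0 (0 : series k).
Proof.
have hc n : hcomp n (0 : series k) = 0 by apply: seriesP => w /=; case: eqP.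
apply/rc0P; split=> //.
- by apply/fr1P; split=> // n; rewrite hc; apply: lie_poly0.
- by apply: seriesP => w /=; rewrite oppr0.
have r0 f : r_series (0 : series k) f = 0 by apply: r_series_depth2.
have m0 : mu (0 : series k) = 0 := linear0 _.
rewrite /reduced_coaction_eq m0 !r0; apply: seriesP => w; coef_push.
by rewrite /= !subr0 oppr0 addr0.
Qed.

Lemma r_series_linear a psi1 psi2 f :
  r_series (a *: psi1 + psi2) f = a *: r_series psi1 f + r_series psi2 f.
Proof.
apply: seriesP => w; rewrite /= mulr_sumr -big_split; apply: eq_bigr => -[[|n] _] _ /=.
  by rewrite !mul0r mulr0 addr0.
by rewrite mulrDl mulrA.
Qed.

Lemma rc0_linear a psi1 psi2 : rc0 psi1 -> rc0 psi2 -> rc0 (a *: psi1 + psi2).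
Proof.
move=> /rc0P[/fr1P[L1 z1 t1] S1 R1 e1] /rc0P[/fr1P[L2 z2 t2] S2 R2 e2].
have z w : psi1 w = 0 -> psi2 w = 0 -> (a *: psi1 + psi2) w = 0.
  by coef_push => -> ->; rewrite mulr0 addr0.
apply/rc0P; split; last exact: z.
- apply/fr1P; split=> n; [|exact: z..].
  have -> : hcomp n (a *: psi1 + psi2) = a *: hcomp n psi1 + hcomp n psi2
    := linearP _ _ _ _.
  exact: lie_poly_lin.
- have -> : swap (a *: psi1 + psi2) = a *: swap psi1 + swap psi2
    := linearP _ _ _ _.
  by rewrite S1 S2; nc_ring.
rewrite /reduced_coaction_eq !r_series_linear.
have -> : mu (a *: psi1 + psi2) = a *: mu psi1 + mu psi2 := linearP _ _ _ _.
have -> i : dL i (a *: psi1 + psi2) = a *: dL i psi1 + dL i psi2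
  := linearP _ _ _ _.
have -> i : dR i (a *: psi1 + psi2) = a *: dR i psi1 + dR i psi2
  := linearP _ _ _ _.
rewrite R1 R2; nc_ring.
Qed.

End ReducedCoaction.

Theorem theorem52 (k : fieldType) (char0 : [pchar k] =i pred0) :
  is_lie_algebra (@rc0 k) (@ihara k) /\
  (forall psi1 psi2 : series k, rc0 psi1 -> rc0 psi2 ->
     mu (ihara psi1 psi2)
     = - dL false (ihara psi1 psi2) - dR true (ihara psi1 psi2)).
Proof.
split; last by move=> psi1 psi2; apply: rc0_mu_ihara.
split.
- exact: rc0_0.
- exact: rc0_linear.
- by move=> u v; apply: rc0_ihara.
- by move=> a u v w _ _ _; apply: ihara_linl.
- by move=> a u v w _ _ _; apply: ihara_linr.
- by move=> u _; apply: ihara_alt.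
- by move=> u v w _ _ _; apply: ihara_jacobi.
Qed.
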